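(* Let $G$ be a finite group, let $(T,[\;],\alpha)$ be a $G$-Hom Lie triple system over a field $k$, and let $V$ be a $k$-vector space with a linear map $A:V\to V$ and a linear action of $G$ on $V$ commuting with $A$. Regard $V$ as a $G$-module over $T$ with respect to $A$ with trivial bilinear map $\theta=0$, and regard $(V,0,A)$ as a $G$-Hom Lie triple system with zero ternary operation. Then the set of equivalence classes of equivariant central extensions of $(T,[\;],\alpha)$ by $(V,0,A)$ is in one-to-one correspondence with the cohomology group $H^3_{G(\alpha,A)}(T,V)$.
   Context: A (multiplicative) Hom Lie triple system $(T,[\;],\alpha)$ over $k$ is a $k$-vector space $T$ with a $k$-trilinear operation $[abc]$ and a linear map $\alpha:T\to T$ such that for all $a,b,c,d,e\in T$: $[aac]=0$; $[abc]+[bca]+[cab]=0$; $[\alpha(a)\alpha(b)[cde]]=[[abc]\alpha(d)\alpha(e)]+[\alpha(c)[abd]\alpha(e)]+[\alpha(c)\alpha(d)[abe]]$; and $\alpha[abc]=[\alpha(a)\alpha(b)\alpha(c)]$. A $G$-Hom Lie triple system is a multiplicative Hom Lie triple system $T$ with a left action of the finite group $G$ by linear maps such that $[ga\,gb\,gc]=g[abc]$ and $\alpha(ga)=g\alpha(a)$ for all $g\in G$, $a,b,c\in T$. A $G$-morphism $f:(T,[\;],\alpha)\to(T',[\;]',\alpha')$ of $G$-Hom Lie triple systems is a linear map with $f[abc]=[f(a)f(b)f(c)]'$, $f\alpha=\alpha' f$ and $f(ga)=gf(a)$ for all $g\in G$ and $a,b,c\in T$; a $G$-isomorphism is a bijective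 $G$-morphism. Equivariant central extension: a $G$-Hom Lie triple system $(T_c,[\;]_c,\alpha_c)$ is an equivariant central extension of $(T,[\;],\alpha)$ by $(V,0,A)$ if there exist an exact sequence $0\to V\xrightarrow{i}T_c\xrightarrow{\pi}T\to 0$ of $G$-Hom Lie triple systems (so $i$ and $\pi$ are $G$-morphisms) and a $G$-morphism $s:T\to T_c$ satisfying $\pi s=\mathrm{id}_T$, and $i(V)\subseteq Z(T_c)$, where the center is $Z(T_c)=\{x\in T_c:[x\,y\,z]_c=0\ \forall y,z\in T_c\}$. In particular $\alpha_c i=iA$, $\alpha\pi=\pi\alpha_c$ and $\alpha_c s=s\alpha$. Two such extensions, $T_c$ with maps $i,\pi$ and $T_c'$ with maps $i',\pi'$, are equivalent if there is a $G$-isomorphism $\phi:T_c\to T_c'$ with $\phi i=i'$ and $\pi'\phi=\pi$. Cohomology (with $\theta=0$): $C^1_{G(\alpha,A)}(T;V)$ is the space of linear maps $f:T\to V$ with $Af=f\alpha$ and $f(gx)=gf(x)$ for all $g\in G$, $x\in T$. $C^3_{G(\alpha,A)}(T;V)$ is the space of trilinear maps $h:T^3\to V$ with $Ah(x,y,z)=h(\alpha(x),\alpha(y),\alpha(z))$, $h(x,x,y)=0$, $h(x,y,z)+h(y,z,x)+h(z,x,y)=0$, and $h(gx,gy,gz)=gh(x,y,z)$ for all $g\in G$ and $x,y,z\in T$. The coboundary maps are $\delta^1f(x,y,z)=-f([xyz])$ and $$\delta^3h(x_1,\dots,x_5)=h([x_1x_2x_3],\alpha(x_4),\alpha(x_5))+h(\alpha(x_3),[x_1x_2x_4],\alpha(x_5))+h(\alpha(x_3),\alpha(x_4),[x_1x_2x_5])-h(\alpha(x_1),\alpha(x_2),[x_3x_4x_5]).$$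 $H^3_{G(\alpha,A)}(T,V)=\{h\in C^3_{G(\alpha,A)}(T;V):\delta^3h=0\}/\delta^1\big(C^1_{G(\alpha,A)}(T;V)\big)$.
   Formalization: The section s in an equivariant central extension is required only to be linear, G-equivariant and to commute with the twists, not to preserve the ternary bracket; if it preserved the bracket every extension would be trivial and the claim would fail whenever the cohomology group is nonzero. *)

(* Defs.v *)
From HB Require Import structures.
From mathcomp Require Import all_boot all_algebra all_fingroup.
From mathcomp Require Import boolp functions.

Set Implicit Arguments.
Unset Strict Implicit.
Unset Printing Implicit Defensive.

Import GRing.Theory.
Local Open Scope ring_scope.
Local Open Scope quotient_scope.

Definition trilinear (k : fieldType) (U W : lmodType k) (f : U -> U -> U -> W) :=
  [/\ forall y z, linear (fun x => f x y z),
      forall x z, linear (fun y => f x y z)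
    & forall x y, linear (fun z => f x y z)].

(* The data (V, A) of the coefficients, which is also what remains of a G-Hom
   Lie triple system when its bracket is forgotten. *)
Record gHomMod (k : fieldType) (G : finGroupType) := GHomMod {
  ghm_car :> lmodType k;
  twist : {linear ghm_car -> ghm_car};
  gact : G -> {linear ghm_car -> ghm_car};
  gact1 : forall x, gact 1%g x = x;
  gactM : forall g h x, gact (g * h)%g x = gact g (gact h x);
  twist_gact : forall g x, twist (gact g x) = gact g (twist x)
}.

Record gHomLTS (k : fieldType) (G : finGroupType) := GHomLTS {
  lts_mod :> gHomMod k G;
  br : lts_mod -> lts_mod -> lts_mod -> lts_mod;
  br_trilinear : trilinear br;
  br_alt : forall a c, br a a c = 0;
  br_cyclic : forall a b c, br a b c + br b c a + br c a b = 0;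
  br_hom_jacobi : forall a b c d e,
    br (twist _ a) (twist _ b) (br c d e) =
      br (br a b c) (twist _ d) (twist _ e)
    + br (twist _ c) (br a b d) (twist _ e)
    + br (twist _ c) (twist _ d) (br a b e);
  br_twist : forall a b c,
    twist _ (br a b c) = br (twist _ a) (twist _ b) (twist _ c);
  br_gact : forall g a b c,
    br (gact _ g a) (gact _ g b) (gact _ g c) = gact _ g (br a b c)
}.

Definition equivariant (k : fieldType) (G : finGroupType) (M N : gHomMod k G)
    (f : {linear M -> N}) : Prop :=
  (forall x, f (twist M x) = twist N (f x)) /\
  (forall g x, f (gact M g x) = gact N g (f x)).

Definition gMorphism (k : fieldType) (G : finGroupType) (T T' : gHomLTS k G)
    (f : {linear T -> T'}) : Prop :=
  (forall a b c, f (br a b c) = br (f a) (f b) (f c)) /\ equivariant f.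

Definition center (k : fieldType) (G : finGroupType) (T : gHomLTS k G) (x : T) :=
  forall y z : T, br x y z = 0.

Section ZeroBracket.
Context (k : fieldType) (G : finGroupType) (V : gHomMod k G).

Let zbr (_ _ _ : V) : V := 0.

Fact zbr_trilinear : trilinear zbr.
Proof. by split=> x y a u v; rewrite /zbr scaler0 addr0. Qed.
Fact zbr_alt a c : zbr a a c = 0. Proof. by []. Qed.
Fact zbr_cyclic a b c : zbr a b c + zbr b c a + zbr c a b = 0.
Proof. by rewrite /zbr !addr0. Qed.
Fact zbr_hom_jacobi a b c d e :
  zbr (twist V a) (twist V b) (zbr c d e) =
    zbr (zbr a b c) (twist V d) (twist V e)
  + zbr (twist V c) (zbr a b d) (twist V e)
  + zbr (twist V c) (twist V d) (zbr a b e).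
Proof. by rewrite /zbr !addr0. Qed.
Fact zbr_twist a b c :
  twist V (zbr a b c) = zbr (twist V a) (twist V b) (twist V c).
Proof. by rewrite /zbr raddf0. Qed.
Fact zbr_gact g a b c :
  zbr (gact V g a) (gact V g b) (gact V g c) = gact V g (zbr a b c).
Proof. by rewrite /zbr raddf0. Qed.

Definition zeroLTS : gHomLTS k G :=
  GHomLTS zbr_trilinear zbr_alt zbr_cyclic zbr_hom_jacobi zbr_twist zbr_gact.

End ZeroBracket.

(* The section s is linear, G-equivariant and commutes with the twists, but is
   not required to preserve the brackets: if it were, every extension would be
   equivalent to the direct product of T and (V, 0, A). *)
Record extension (k : fieldType) (G : finGroupType) (T : gHomLTS k G)
    (V : gHomMod k G) := Extension {
  ext_lts :> gHomLTS k G;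
  ext_i : {linear zeroLTS V -> ext_lts};
  ext_pi : {linear ext_lts -> T};
  ext_i_morphism : gMorphism ext_i;
  ext_pi_morphism : gMorphism ext_pi;
  ext_i_inj : injective ext_i;
  ext_exact : forall x, ext_pi x = 0 <-> exists v, ext_i v = x;
  ext_pi_surj : forall y, exists x, ext_pi x = y;
  ext_section : exists s : {linear T -> ext_lts},
    equivariant s /\ forall y, ext_pi (s y) = y;
  ext_central : forall v, center (ext_i v)
}.

Section ExtensionClasses.
Context (k : fieldType) (G : finGroupType) (T : gHomLTS k G) (V : gHomMod k G).
Implicit Types E F : extension T V.

Definition ext_equiv E F : Prop :=
  exists phi : {linear E -> F},
    [/\ gMorphism phi, bijective phi,
        forall v, phi (ext_i E v) = ext_i F v
      & forall x, ext_pi F (phi x) = ext_pi E x].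

Lemma ext_equiv_refl E : ext_equiv E E.
Proof. by exists idfun; split=> //; exists id. Qed.

Lemma ext_equiv_sym E F : ext_equiv E F -> ext_equiv F E.
Proof.
case=> phi [[phi_br [phi_tw phi_g]] [psi phiK psiK] phi_i phi_pi].
have psi_lin : linear psi.
  by move=> a x y; apply: (can_inj phiK); rewrite linearP !psiK.
pose psiL : {linear F -> E} :=
  HB.pack psi (GRing.isLinear.Build k F E *:%R psi psi_lin).
exists psiL; split.
- split=> [a b c|]; first by apply: (can_inj phiK); rewrite phi_br !psiK.
  by split=> [x|g x]; apply: (can_inj phiK); rewrite ?phi_tw ?phi_g !psiK.
- by exists phi.
- by move=> v; rewrite -phi_i; apply: phiK.
- by move=> x; rewrite -phi_pi /= psiK.
Qed.

Lemma ext_equiv_trans F E H : ext_equiv E F -> ext_equiv F H -> ext_equiv E H.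
Proof.
case=> f [[f_br [f_tw f_g]] f_bij f_i f_pi].
case=> h [[h_br [h_tw h_g]] h_bij h_i h_pi].
exists (h \o f : {linear E -> H}); split.
- split=> [a b c|] /=; first by rewrite f_br h_br.
  by split=> [x|g x] /=; rewrite ?f_tw ?h_tw ?f_g ?h_g.
- exact: bij_comp.
- by move=> v /=; rewrite f_i h_i.
- by move=> x /=; rewrite h_pi f_pi.
Qed.

Definition is_ext_class (C : extension T V -> Prop) : Prop :=
  exists E, C = ext_equiv E.

(* An explicit set of sets: the type of extensions lies in too large a universe
   to be a choiceType, so {eq_quot _} does not apply. *)
Definition ext_classes := {C : extension T V -> Prop | is_ext_class C}.

End ExtensionClasses.

Section Cohomology.
Context (k : fieldType) (G : finGroupType) (T : gHomLTS k G) (V : gHomMod k G).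
Implicit Types (f : {linear T -> V}) (h : T -> T -> T -> V).

Definition cochain1 f : Prop :=
  (forall x, twist V (f x) = f (twist T x)) /\
  (forall g x, f (gact T g x) = gact V g (f x)).

Definition cochain3 h : Prop :=
  [/\ trilinear h,
      forall x y z, twist V (h x y z) = h (twist T x) (twist T y) (twist T z),
      forall x y, h x x y = 0,
      forall x y z, h x y z + h y z x + h z x y = 0
    & forall g x y z, h (gact T g x) (gact T g y) (gact T g z) =
        gact V g (h x y z)].

Definition delta1 f : T -> T -> T -> V := fun x y z => - f (br x y z).

Definition delta3 h : T -> T -> T -> T -> T -> V := fun x1 x2 x3 x4 x5 =>
    h (br x1 x2 x3) (twist T x4) (twist T x5)
  + h (twist T x3) (br x1 x2 x4) (twist T x5)
  + h (twist T x3) (twist T x4) (br x1 x2 x5)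
  - h (twist T x1) (twist T x2) (br x3 x4 x5).

Definition cocycle3 : {pred T -> T -> T -> V} :=
  fun h => `[< cochain3 h /\ forall x1 x2 x3 x4 x5, delta3 h x1 x2 x3 x4 x5 = 0 >].

Fact cocycle3_zmod_closed : zmod_closed cocycle3.
Proof.
split.
  apply/asboolP; split; last by move=> *; rewrite /delta3 /= !addr0 subr0.
  split=> //.
  - by split=> x y a u v /=; rewrite scaler0 addr0.
  - by move=> x y z; rewrite raddf0.
  - by move=> x y z; rewrite !addr0.
  - by move=> g x y z; rewrite raddf0.
move=> h h' /asboolP[[[l1 l2 l3] tw alt cyc eqv] dh].
move=> /asboolP[[[l1' l2' l3'] tw' alt' cyc' eqv'] dh'].
have E x y z : (h - h') x y z = h x y z - h' x y z by [].
have D (a b c d : V) : a - b + (c - d) = a + c - (b + d).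
  by rewrite opprD addrACA.
have B (a b c d : V) : a - b - (c - d) = a - c - (b - d).
  by rewrite !opprB addrACA [- b - c]addrC addrACA.
apply/asboolP; split; first split.
- split=> x y a u v; rewrite !E.
  + by rewrite (l1 x y) (l1' x y) scalerBr opprD addrACA.
  + by rewrite (l2 x y) (l2' x y) scalerBr opprD addrACA.
  + by rewrite (l3 x y) (l3' x y) scalerBr opprD addrACA.
- by move=> x y z; rewrite !E linearB tw tw'.
- by move=> x y; rewrite E alt alt' subr0.
- by move=> x y z; rewrite !E !D cyc cyc' subr0.
- by move=> g x y z; rewrite !E eqv eqv' linearB.
move=> x1 x2 x3 x4 x5; rewrite /delta3 !E !D B.
by rewrite [X in X - _]dh [X in _ - X]dh' subr0.
Qed.

HB.instance Definition _ :=
  GRing.isZmodClosed.Build (T -> T -> T -> V) cocycle3 cocycle3_zmod_closed.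

Record Z3 := MkZ3 { z3_val :> T -> T -> T -> V; _ : z3_val \in cocycle3 }.

HB.instance Definition _ := [isSub for z3_val].
HB.instance Definition _ := [Choice of Z3 by <:].
HB.instance Definition _ := [SubChoice_isSubZmodule of Z3 by <:].

Definition coboundary3 : {pred Z3} :=
  fun z => `[< exists f, cochain1 f /\ z3_val z = delta1 f >].

Fact coboundary3_zmod_closed : zmod_closed coboundary3.
Proof.
split.
  apply/asboolP; exists \0; split.
    by split=> [x|g x] /=; rewrite raddf0.
  by do 3!apply/funext=> ?; rewrite /delta1 /= oppr0.
move=> h h' /asboolP[f [[ftw fg] hf]] /asboolP[f' [[ftw' fg'] hf']].
apply/asboolP; exists (f \- f'); split.
  by split=> [x|g x] /=; rewrite linearB ?ftw ?ftw' ?fg ?fg'.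
rewrite [LHS](raddfB (val : Z3 -> _)) /= hf hf'.
apply/funext=> x; apply/funext=> y; apply/funext=> z.
rewrite -[LHS]/(- f (br x y z) - - f' (br x y z)) /delta1 /=.
by rewrite opprK opprB addrC.
Qed.

HB.instance Definition _ :=
  GRing.isZmodClosed.Build Z3 coboundary3 coboundary3_zmod_closed.

Definition H3 : zmodType := Quotient.quot coboundary3.

End Cohomology.

(* Main.v *)
From mathcomp Require Import all_boot all_algebra all_fingroup.
From HB Require Import structures.
From mathcomp Require Import boolp functions.
Require Import Defs.

Set Implicit Arguments.
Unset Strict Implicit.
Unset Printing Implicit Defensive.

Import GRing.Theory.
Local Open Scope ring_scope.
Local Open Scope quotient_scope.

(** The theorem is the third-cohomology version of the classification of
central extensions by 2-cocycles.

An equivariant section s of an extension E of T by V identifies E with T * V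
as a module with twist and G-action.  Under this identification the bracket of
E is the bracket of T together with a V-valued error h, where
[s x, s y, s z] = s [x y z] + i (h x y z); there is no further data, because
i(V) is central, so that brackets do not see the V-components of their
arguments.  Writing r : E -> V for the retraction attached to s, one has
h x y z = r [s x, s y, s z], and each identity required of a 3-cocycle is the
image under r of the corresponding axiom of E: the Hom Jacobi identity gives
delta3 h = 0 ([exists_cocycle]).  Conversely, for a cocycle z the bracket
([x y z], z x y z) on T * V defines an extension ([cocycle_ext]).

Two sections of the same extension differ by i o f for a 1-cochain f, and
this change of section changes the cocycle by delta1 f
([cocycles_cohomologous], [has_cocycle_cohomologous]).  Equivalences
transport sections ([ext_equiv_has_cocycle]), and two extensions with a common
cocycle are equivalent ([has_cocycle_ext_equiv]).  So two extensions are
equivalent exactly when their cocycles define the same class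
([ext_equiv_iff_pi_eq]), and the bijection sends the class of an extension to
the class of any of its cocycles. *)

(** * Linear and trilinear maps *)

Section Fork.
Context (k : fieldType) (U V W : lmodType k).

Definition fork (f : {linear U -> V}) (g : {linear U -> W}) (x : U) :
  (V * W)%type := (f x, g x).

Fact fork_linear f g : linear (fork f g).
Proof. by move=> a x y; rewrite /fork !linearP. Qed.

HB.instance Definition _ f g :=
  GRing.isLinear.Build k U (V * W)%type *:%R (fork f g) (fork_linear f g).

End Fork.

Lemma trilinearD (k : fieldType) (U W : lmodType k) (f : U -> U -> U -> W) :
  trilinear f -> [/\ forall a b y z, f (a + b) y z = f a y z + f b y z,
    forall a b x z, f x (a + b) z = f x a z + f x b z
  & forall a b x y, f x y (a + b) = f x y a + f x y b].
Proof.
case=> l1 l2 l3; split=> a b x y.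
- by have := l1 x y 1 a b; rewrite !scale1r.
- by have := l2 x y 1 a b; rewrite !scale1r.
- by have := l3 x y 1 a b; rewrite !scale1r.
Qed.

Lemma trilinear0l (k : fieldType) (U W : lmodType k) (f : U -> U -> U -> W) :
  trilinear f -> forall y z, f 0 y z = 0.
Proof.
by case/trilinearD=> D _ _ y z; apply: (addrI (f 0 y z)); rewrite -D !addr0.
Qed.

(** * The cocycles of an extension *)

Section Extensions.
Context (k : fieldType) (G : finGroupType) (T : gHomLTS k G) (V : gHomMod k G).

Lemma z3B (z z' : Z3 T V) x y t : (z - z') x y t = z x y t - z' x y t.
Proof.
by have /(congr1 (fun h => h x y t)) := raddfB (val : Z3 T V -> _) z z'.
Qed.

Section OneExtension.
Variable E : extension T V.
Implicit Types (v : V) (a b c e : E).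

Lemma ext_pi_i v : ext_pi E (ext_i E v) = 0.
Proof. by apply/(ext_exact (ext_i E v)); exists v. Qed.

Lemma br_addi1 a b c v : br (a + ext_i E v) b c = br a b c.
Proof.
have [D _ _] := trilinearD (br_trilinear E).
by rewrite D ext_central addr0.
Qed.

(** Centrality is stated for the first argument only; it passes to the second
by alternation, and then to the third by the cyclic identity. *)
Lemma br_addi2 a b c v : br a (b + ext_i E v) c = br a b c.
Proof.
have [D1 D2 _] := trilinearD (br_trilinear E).
suff z : br a (ext_i E v) c = 0 by rewrite D2 z addr0.
have := br_alt (a + ext_i E v) c.
by rewrite D1 !D2 !ext_central br_alt add0r !addr0.
Qed.

Lemma br_addi3 a b c v : br a b (c + ext_i E v) = br a b c.
Proof.
have [_ D2 D3] := trilinearD (br_trilinear E).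
have z2 : br b (ext_i E v) a = 0.
  by apply: (addrI (br b a a)); rewrite -D2 br_addi2 addr0.
have := br_cyclic a b (ext_i E v).
by rewrite z2 ext_central !addr0 D3 => ->; rewrite addr0.
Qed.

Definition is_section (s : {linear T -> E}) : Prop :=
  equivariant s /\ forall y, ext_pi E (s y) = y.

(** A section splits the underlying sequence of modules with twist and
G-action: e - s (pi e) lies in the kernel of pi, hence comes from a unique
element of V, and uniqueness makes the choice linear and equivariant. *)
Lemma retraction s : is_section s ->
  exists r : {linear E -> V},
    [/\ equivariant r,
        forall e, e = s (ext_pi E e) + ext_i E (r e),
        forall y, r (s y) = 0
      & forall v, r (ext_i E v) = v].
Proof.
case=> [[s_tw s_g] sK].
have [_ [i_tw i_g]] := ext_i_morphism E.
have [_ [pi_tw pi_g]] := ext_pi_morphism E.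
have i_inj := @ext_i_inj _ _ _ _ E.
have /choice[r rE] : forall e, exists v, ext_i E v = e - s (ext_pi E e).
  by move=> e; apply/ext_exact; rewrite linearB sK subrr.
have r_lin : linear r.
  move=> a x y; apply: i_inj.
  by rewrite linearP !rE !linearP scalerBr addrACA scalerN.
pose rL : {linear E -> V} :=
  HB.pack r (GRing.isLinear.Build k E V *:%R r r_lin).
exists rL; split.
- split=> [x|g x]; apply: i_inj.
    by rewrite rE pi_tw s_tw -linearB -rE -i_tw.
  by rewrite rE pi_g s_g -linearB -rE -i_g.
- by move=> e; rewrite /= rE addrC subrK.
- by move=> y; apply: i_inj; rewrite rE sK subrr linear0.
- by move=> v; apply: i_inj; rewrite rE ext_pi_i linear0 subr0.
Qed.

Definition section_cocycle (s : {linear T -> E}) (h : T -> T -> T -> V) :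
    Prop :=
  is_section s /\
  forall x y z, br (s x) (s y) (s z) = s (br x y z) + ext_i E (h x y z).

(** An extension has one cocycle for each of its sections, so being a cocycle
of E is a relation and not a function of E. *)
Definition has_cocycle (h : T -> T -> T -> V) : Prop :=
  exists s, section_cocycle s h.

(** The cocycle is r o [ , , ] o (s, s, s).  As s and r are equivariant linear
maps, applying r to the axioms of E at points of s(T) yields the axioms of a
cochain; in the Hom Jacobi identity of E, centrality allows the inner brackets
[s x, s y, s z] to be replaced by s [x y z], and what r returns is delta3. *)
Lemma exists_cocycle : exists z : Z3 T V, has_cocycle z.
Proof.
have [s sP] := ext_section E; have [[s_tw s_g] sK] := sP.
have [r [[r_tw r_g] dec _ _]] := retraction sP.
have [pi_br _] := ext_pi_morphism E.
pose h x y z := r (br (s x) (s y) (s z)).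
have hE x y z : br (s x) (s y) (s z) = s (br x y z) + ext_i E (h x y z).
  by rewrite [LHS]dec pi_br !sK.
suff hP : h \in @cocycle3 k G T V by exists (MkZ3 hP), s.
have [l1 l2 l3] := br_trilinear E.
apply/asboolP; split; first split; rewrite /h.
- by split=> x y a u v; rewrite linearP (l1, l2, l3) linearP.
- by move=> x y z; rewrite !s_tw -br_twist r_tw.
- by move=> x y; rewrite br_alt linear0.
- by move=> x y z; rewrite -!linearD br_cyclic linear0.
- by move=> g x y z; rewrite !s_g br_gact r_g.
move=> x1 x2 x3 x4 x5; rewrite /delta3.
have := br_hom_jacobi (s x1) (s x2) (s x3) (s x4) (s x5).
rewrite (hE x3) (hE x1 x2 x3) (hE x1 x2 x4) (hE x1 x2 x5).
rewrite br_addi1 br_addi2 !br_addi3 -!s_tw => /(congr1 r) ->.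
by rewrite !(linearD r) subrr.
Qed.

(** If r' is the retraction of the second section s', then s = s' + i o f with
f = r' o s.  Evaluating r' on [s x, s y, s z] with either section compares the
two cocycles, and the difference is - f [x y z]. *)
Lemma cocycles_cohomologous (z z' : Z3 T V) :
  has_cocycle z -> has_cocycle z' -> z - z' \in @coboundary3 k G T V.
Proof.
case=> s [sP sE] [s' [s'P s'E]].
have [[s_tw s_g] sK] := sP.
have [r [[r_tw r_g] dec rs ri]] := retraction s'P.
have sD x : s x = s' x + ext_i E (r (s x)) by rewrite {1}[s x]dec sK.
apply/asboolP; exists (r \o s : {linear T -> V}); split.
  by split=> [x|g x] /=; rewrite ?s_tw ?s_g ?r_tw ?r_g.
apply/funext=> x; apply/funext=> y; apply/funext=> t.
have := sE x y t; rewrite (sD x) (sD y) (sD t).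
rewrite br_addi1 br_addi2 br_addi3 s'E => /(congr1 r).
rewrite !linearD rs !ri add0r z3B /delta1 /= => ->.
by rewrite opprD addrCA subrr addr0.
Qed.

(** If z - z' = delta1 f, then z' is the cocycle of the section s - i o f. *)
Lemma has_cocycle_cohomologous (z z' : Z3 T V) :
  has_cocycle z -> z - z' \in @coboundary3 k G T V -> has_cocycle z'.
Proof.
case=> s [[[s_tw s_g] sK] sE] /asboolP[f [[f_tw f_g] fE]].
have [_ [i_tw i_g]] := ext_i_morphism E.
exists (s \- (ext_i E \o f : {linear T -> E})); split; first split.
- split=> [x|g x] /=; first by rewrite linearB s_tw -i_tw -f_tw.
  by rewrite linearB s_g -i_g -f_g.
- by move=> y; rewrite /= linearB sK ext_pi_i subr0.
move=> x y t; rewrite /= -!linearN br_addi1 br_addi2 br_addi3 sE.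
rewrite linearN /= -addrA -linearN -linearD /=; congr (_ + ext_i E _).
have /(congr1 (fun h => h x y t)) := fE.
by rewrite z3B /delta1 -linearN => /eqP; rewrite subr_eq => /eqP ->.
Qed.

End OneExtension.

(** * Comparison of extensions *)

Lemma ext_equiv_has_cocycle (E F : extension T V) h :
  ext_equiv E F -> has_cocycle E h -> has_cocycle F h.
Proof.
case=> phi [[phi_br [phi_tw phi_g]] _ phi_i phi_pi].
case=> s [[[s_tw s_g] sK] sE]; exists (phi \o s : {linear T -> F}).
split; first split; first split=> [x|g x] /=.
- by rewrite s_tw phi_tw.
- by rewrite s_g phi_g.
- by move=> y /=; rewrite phi_pi.
by move=> x y z /=; rewrite -phi_br sE linearD phi_i.
Qed.

(** The sections decompose E and F as T * V; the equivalence is the identity of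
T * V in these coordinates, s x + i v |-> s' x + i' v, and it preserves the
brackets because their V-components are both given by h. *)
Lemma has_cocycle_ext_equiv (E F : extension T V) h :
  has_cocycle E h -> has_cocycle F h -> ext_equiv E F.
Proof.
case=> s [sP sE] [s' [s'P s'E]].
have [r [[r_tw r_g] dec rs ri]] := retraction sP.
have [r' [_ dec' rs' ri']] := retraction s'P.
have [[s_tw s_g] sK] := sP; have [[s'_tw s'_g] s'K] := s'P.
have [pi_br [pi_tw pi_g]] := ext_pi_morphism E.
have [_ [i_tw i_g]] := ext_i_morphism F.
pose phi : {linear E -> F} := (s' \o ext_pi E) \+ (ext_i F \o r).
pose psi : {linear F -> E} := (s \o ext_pi F) \+ (ext_i E \o r').
exists phi; split.
- split.
    move=> a b c; rewrite /phi /= br_addi1 br_addi2 br_addi3 s'E.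
    rewrite pi_br; congr (_ + ext_i F _).
    rewrite [a in LHS]dec [b in LHS]dec [c in LHS]dec.
    by rewrite br_addi1 br_addi2 br_addi3 sE linearD rs ri add0r.
  split=> [x|g x]; rewrite /phi /= linearD.
    by rewrite pi_tw s'_tw r_tw i_tw.
  by rewrite pi_g s'_g r_g i_g.
- exists psi => x; rewrite /phi /psi /=.
    by rewrite !linearD /= s'K ext_pi_i rs' ri' !linear0 addr0 add0r -dec.
  by rewrite !linearD /= sK ext_pi_i rs ri !linear0 addr0 add0r -dec'.
- by move=> v; rewrite /phi /= ext_pi_i ri linear0 add0r.
- by move=> x; rewrite /phi /= linearD s'K ext_pi_i addr0.
Qed.

(** * The extension defined by a cocycle *)

Section CocycleExtension.
Variable z : Z3 T V.

Let E := (T * V)%type.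

Definition cocycle_br (a b c : E) : E := (br a.1 b.1 c.1, z a.1 b.1 c.1).

Definition cocycle_twist : {linear E -> E} :=
  fork (twist T \o fst) (twist V \o snd).
Definition cocycle_gact (g : G) : {linear E -> E} :=
  fork (gact T g \o fst) (gact V g \o snd).

Fact cocycle_gact1 x : cocycle_gact 1%g x = x.
Proof. by case: x => x v; rewrite /= /fork /= !gact1. Qed.
Fact cocycle_gactM g h x :
  cocycle_gact (g * h)%g x = cocycle_gact g (cocycle_gact h x).
Proof. by rewrite /= /fork /= !gactM. Qed.
Fact cocycle_twist_gact g x :
  cocycle_twist (cocycle_gact g x) = cocycle_gact g (cocycle_twist x).
Proof. by rewrite /= /fork /= !twist_gact. Qed.

Definition cocycle_mod : gHomMod k G :=
  GHomMod cocycle_gact1 cocycle_gactM cocycle_twist_gact.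

Let zP : cochain3 z /\ forall x1 x2 x3 x4 x5, delta3 z x1 x2 x3 x4 x5 = 0.
Proof. by case: z => h hP; apply/asboolP. Qed.

Fact cocycle_br_trilinear : trilinear (cocycle_br : cocycle_mod -> _).
Proof.
have [[[l1 l2 l3] _ _ _ _] _] := zP; have [t1 t2 t3] := br_trilinear T.
split=> x y a u v; rewrite /cocycle_br.
- by rewrite (t1 _ _ a) (l1 _ _ a).
- by rewrite (t2 _ _ a) (l2 _ _ a).
- by rewrite (t3 _ _ a) (l3 _ _ a).
Qed.
Fact cocycle_br_alt a c : cocycle_br a a c = 0.
Proof. by have [[_ _ alt _ _] _] := zP; rewrite /cocycle_br br_alt alt. Qed.
Fact cocycle_br_cyclic a b c :
  cocycle_br a b c + cocycle_br b c a + cocycle_br c a b = 0.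
Proof.
have [[_ _ _ cyc _] _] := zP.
by congr pair; rewrite /= ?br_cyclic ?cyc.
Qed.
Fact cocycle_br_hom_jacobi a b c d e :
  cocycle_br (cocycle_twist a) (cocycle_twist b) (cocycle_br c d e) =
    cocycle_br (cocycle_br a b c) (cocycle_twist d) (cocycle_twist e)
  + cocycle_br (cocycle_twist c) (cocycle_br a b d) (cocycle_twist e)
  + cocycle_br (cocycle_twist c) (cocycle_twist d) (cocycle_br a b e).
Proof.
have [_ dz] := zP.
congr pair; rewrite /=; first exact: br_hom_jacobi.
by apply/esym/eqP; rewrite -subr_eq0; apply/eqP; exact: dz.
Qed.
Fact cocycle_br_twist a b c :
  cocycle_twist (cocycle_br a b c) =
  cocycle_br (cocycle_twist a) (cocycle_twist b) (cocycle_twist c).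
Proof.
have [[_ tw _ _ _] _] := zP.
by congr pair; rewrite /= ?br_twist ?tw.
Qed.
Fact cocycle_br_gact g a b c :
  cocycle_br (cocycle_gact g a) (cocycle_gact g b) (cocycle_gact g c) =
  cocycle_gact g (cocycle_br a b c).
Proof.
have [[_ _ _ _ eqv] _] := zP.
by congr pair; rewrite /= ?br_gact ?eqv.
Qed.

Definition cocycle_lts : gHomLTS k G :=
  @GHomLTS k G cocycle_mod cocycle_br cocycle_br_trilinear cocycle_br_alt
    cocycle_br_cyclic cocycle_br_hom_jacobi cocycle_br_twist cocycle_br_gact.

Definition cocycle_i : {linear zeroLTS V -> cocycle_lts} :=
  fork (\0 : {linear V -> T}) idfun.
Definition cocycle_s : {linear T -> cocycle_lts} :=
  fork idfun (\0 : {linear T -> V}).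
Definition cocycle_pi : {linear cocycle_lts -> T} := fst.

Fact cocycle_central v : center (cocycle_i v).
Proof.
have [[lz _ _ _ _] _] := zP.
move=> a b; congr pair; first exact: trilinear0l (br_trilinear T) _ _.
exact: trilinear0l lz _ _.
Qed.

Fact cocycle_i_morphism : gMorphism cocycle_i.
Proof.
split=> [a b c|]; first by rewrite cocycle_central linear0.
by split=> [x|g x]; congr pair; rewrite /= linear0.
Qed.

Fact cocycle_pi_morphism : gMorphism cocycle_pi.
Proof. by []. Qed.

Fact cocycle_i_inj : injective cocycle_i.
Proof. by move=> x y []. Qed.

Fact cocycle_exact (x : cocycle_lts) :
  cocycle_pi x = 0 <-> exists v, cocycle_i v = x.
Proof.
split=> [|[v <-] //]; case: x => x v /= ->.
by exists v.
Qed.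

Fact cocycle_pi_surj y : exists x, cocycle_pi x = y.
Proof. by exists (y, 0). Qed.

Fact cocycle_is_section :
  equivariant cocycle_s /\ forall y, cocycle_pi (cocycle_s y) = y.
Proof.
by split=> //; split=> [x|g x]; congr pair; rewrite /= linear0.
Qed.

Definition cocycle_ext : extension T V :=
  Extension cocycle_i_morphism cocycle_pi_morphism cocycle_i_inj cocycle_exact
    cocycle_pi_surj (ex_intro _ _ cocycle_is_section) cocycle_central.

Lemma cocycle_ext_has_cocycle : has_cocycle cocycle_ext z.
Proof.
exists cocycle_s; split; first exact: cocycle_is_section.
by move=> x y t; congr pair; rewrite /= ?addr0 ?add0r.
Qed.

End CocycleExtension.

(** * The classification *)

Definition class_of (E : extension T V) : ext_classes T V :=
  exist _ (ext_equiv E) (ex_intro _ E erefl).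

Lemma class_ofP (E F : extension T V) :
  class_of E = class_of F <-> ext_equiv E F.
Proof.
split=> [[->]|EF]; first exact: ext_equiv_refl.
apply: eq_exist; apply/funext=> H; apply/propext.
split; apply: ext_equiv_trans => //; exact: ext_equiv_sym.
Qed.

Lemma ext_equiv_iff_pi_eq (E F : extension T V) (z z' : Z3 T V) :
  has_cocycle E z -> has_cocycle F z' ->
  ext_equiv E F <-> \pi_(H3 T V) z = \pi_(H3 T V) z'.
Proof.
move=> Ez Fz'; split=> [EF|/eqP].
  apply/eqP; rewrite -Quotient.idealrBE.
  exact: cocycles_cohomologous (ext_equiv_has_cocycle EF Ez) Fz'.
rewrite -Quotient.idealrBE => zz'.
by apply: has_cocycle_ext_equiv Fz'; apply: has_cocycle_cohomologous Ez _.
Qed.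

End Extensions.

Theorem theorem4p1 (k : fieldType) (G : finGroupType) (T : gHomLTS k G)
    (V : gHomMod k G) :
  exists Phi : ext_classes T V -> H3 T V, bijective Phi.
Proof.
(* Choose a representative of each class, and a cocycle of each extension. *)
have /choice[rep repE] : forall C : ext_classes T V, exists E, C = class_of E.
  by case=> C [E CE]; exists E; apply: eq_exist.
have /choice[coc cocP] := @exists_cocycle k G T V.
exists (fun C => \pi_(H3 T V) (coc (rep C))).
exists (fun q => class_of (cocycle_ext (generic_quotient.repr q))) => [C|q].
  rewrite [RHS]repE; apply/class_ofP.
  apply/(ext_equiv_iff_pi_eq (cocycle_ext_has_cocycle _) (cocP _)).
  by rewrite reprK.
rewrite -[RHS]reprK.
apply/(ext_equiv_iff_pi_eq (cocP _) (cocycle_ext_has_cocycle _)).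
by apply/class_ofP; rewrite -repE.
Qed.
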